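(* Let $N\ge 1$. The partially ordered set $(\mathcal{M}_N,\sqsubseteq)$, equipped with the rank function $\hat r$, is isomorphic to the bounded modular lattice of all linear subspaces of $\mathbb{R}^{N-1}$ (ordered by inclusion and graded by vector space dimension). That is, there is an isomorphism of partially ordered sets (hence of lattices) between $(\mathcal{M}_N,\sqsubseteq)$ and the lattice of linear subspaces of $\mathbb{R}^{N-1}$ under which $\hat r$ corresponds to the dimension.
   Context: Let $M_N$ be the set of real matrices $A$ with $N$ columns and any number of rows such that the vector $\mathbf{1}=(1,\dots,1)\in\mathbb{R}^N$ belongs to the real row span $\operatorname{Row}(A)\subseteq\mathbb{R}^N$ of $A$ (equivalently, there is a linear form $\xi$ with $\xi A=\mathbf{1}$). Define an equivalence relation on $M_N$ by $A\sim B \Leftrightarrow \operatorname{Row}(A)=\operatorname{Row}(B)$, and let $\mathcal{M}_N=M_N/\sim$, with $[A]$ denoting the class of $A$. Define a partial order on $\mathcal{M}_N$ by $[B]\sqsubseteq[A] \Leftrightarrow \operatorname{Row}(A)\subseteq\operatorname{Row}(B)$. Let $r([A])$ be the rank of the matrix $A$, i.e. $\dim\operatorname{Row}(A)$, and set $\hat r([A])=N-r([A])\in\{0,\dots,N-1\}$. *)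

(* Defs.v *)
From HB Require Import structures.
From mathcomp Require Import all_boot all_order all_algebra.
From mathcomp Require Import reals.

Set Implicit Arguments.
Unset Strict Implicit.
Unset Printing Implicit Defensive.

Import Order.TTheory GRing.Theory Num.Theory.
Local Open Scope ring_scope.
Local Open Scope quotient_scope.

Fact calM_display : Order.disp_t. Proof. exact: Order.Disp tt tt. Qed.
Fact vspace_display : Order.disp_t. Proof. exact: Order.Disp tt tt. Qed.

Section MN.
Variables (R : realType) (N : nat).

(* Row(A) is handled through the library's row-space calculus: for matrices A
   and B with N columns, (A <= B)%MS means Row(A) \subseteq Row(B), and
   (A == B)%MS means Row(A) = Row(B).  In particular a row vector v satisfies
   (v <= A)%MS iff v \in Row(A) iff v = xi *m A for some xi (lemma submxP). *)
Record onesmx := OnesMx {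
  onesmx_val : {m : nat & 'M[R]_(m, N)};
  _ : ((const_mx 1 : 'rV[R]_N) <= tagged onesmx_val)%MS }.

HB.instance Definition _ := [isSub for onesmx_val].
HB.instance Definition _ := [Choice of onesmx by <:].

Definition mx_of (A : onesmx) : 'M[R]_(tag (val A), N) := tagged (val A).

Definition same_rows : rel onesmx := fun A B => (mx_of A == mx_of B)%MS.

Lemma same_rows_equiv : equiv_class_of same_rows.
Proof.
split=> [A|A B|B A C]; rewrite /same_rows.
- by apply/andP; split; apply: submx_refl.
- by rewrite andbC.
- case/andP=> AB BA /andP[BC CB]; apply/andP.
  by split; [apply: submx_trans AB BC | apply: submx_trans CB BA].
Qed.

Canonical same_rows_equivRel := EquivRelPack same_rows_equiv.

Definition calM := {eq_quot same_rows}.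

HB.instance Definition _ := Choice.on calM.
HB.instance Definition _ := EqQuotient.on calM.

Definition cls (A : onesmx) : calM := \pi_calM A.

Lemma eq_cls A B : (cls A == cls B) = (mx_of A == mx_of B)%MS.
Proof. exact: eqmodE. Qed.

Lemma repr_cls A : (mx_of (repr (cls A)) :=: mx_of A)%MS.
Proof. by apply/eqmxP; rewrite -eq_cls /cls reprK. Qed.

Definition calM_le : rel calM :=
  fun x y => (mx_of (repr y) <= mx_of (repr x))%MS.

Lemma calM_le_refl : reflexive calM_le.
Proof. by move=> x; apply: submx_refl. Qed.

Lemma calM_le_anti : antisymmetric calM_le.
Proof.
move=> x y; rewrite /calM_le andbC => xy.
by apply/eqP; rewrite -[x]reprK -[y]reprK [_ == _]eq_cls.
Qed.

Lemma calM_le_trans : transitive calM_le.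
Proof. by move=> y x z yx zy; apply: submx_trans zy yx. Qed.

HB.instance Definition _ := Order.Le_isPOrder.Build calM_display calM
  calM_le_refl calM_le_anti calM_le_trans.

Lemma le_cls A B : (cls B <= cls A)%O = (mx_of A <= mx_of B)%MS.
Proof.
rewrite -[LHS]/(calM_le (cls B) (cls A)) /calM_le.
by rewrite (repr_cls A) (repr_cls B).
Qed.

Definition rk (x : calM) : nat := \rank (mx_of (repr x)).

Lemma rk_cls A : rk (cls A) = \rank (mx_of A).
Proof. by rewrite /rk (repr_cls A). Qed.

Definition rhat (x : calM) : nat := (N - rk x)%N.

End MN.

Section SubspaceLattice.
Variables (K : fieldType) (vT : vectType K).
Implicit Types U V W : {vspace vT}.

Definition vspace_le : rel {vspace vT} := fun U V => (U <= V)%VS.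

Lemma vspace_le_refl : reflexive vspace_le.
Proof. exact: subvv. Qed.

Lemma vspace_le_anti : antisymmetric vspace_le.
Proof. by move=> U V /andP[UV VU]; apply/eqP; rewrite eqEsubv; apply/andP. Qed.

Lemma vspace_le_trans : transitive vspace_le.
Proof. exact: subv_trans. Qed.

HB.instance Definition _ :=
  Order.Le_isPOrder.Build vspace_display {vspace vT}
    vspace_le_refl vspace_le_anti vspace_le_trans.

Lemma vspace_meetP U V W : (U <= V :&: W)%VS = (U <= V)%VS && (U <= W)%VS.
Proof. exact: subv_cap. Qed.

Lemma vspace_joinP U V W : (U + V <= W)%VS = (U <= W)%VS && (V <= W)%VS.
Proof. exact: subv_add. Qed.

HB.instance Definition _ :=
  Order.POrder_MeetJoin_isLattice.Build vspace_display {vspace vT}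
    vspace_meetP vspace_joinP.

HB.instance Definition _ :=
  Order.hasBottom.Build vspace_display {vspace vT} (@sub0v K vT).
HB.instance Definition _ :=
  Order.hasTop.Build vspace_display {vspace vT} (@subvf K vT).

End SubspaceLattice.

Local Open Scope order_scope.

Section OrderNotions.

Definition is_lub d (T : porderType d) (x y z : T) : Prop :=
  forall t : T, (z <= t) = (x <= t) && (y <= t).

Definition is_glb d (T : porderType d) (x y z : T) : Prop :=
  forall t : T, (t <= z) = (t <= x) && (t <= y).

Definition modular d (L : latticeType d) : Prop :=
  forall x y z : L, x <= z -> x `|` (y `&` z) = (x `|` y) `&` z.

Definition covers d (T : porderType d) (x y : T) : Prop :=
  x < y /\ forall z : T, ~~ ((x < z) && (z < y)).

Definition rank_function d (T : porderType d) (rho : T -> nat) : Prop :=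
  (forall x y : T, x < y -> (rho x < rho y)%N) /\
  (forall x y : T, covers x y -> rho y = (rho x).+1).

End OrderNotions.

(* Main.v *)
Require Import Defs.
From HB Require Import structures.
From mathcomp Require Import all_boot all_order all_algebra.
From mathcomp Require Import reals.

(** Put the standard scalar product on R^N. The spaces Row(A) containing 1
    correspond, under orthogonal complement, to the subspaces of the hyperplane
    1^\perp, and the order of M_N is reverse inclusion, so this correspondence
    is an isomorphism; a matrix P whose rows form a basis of 1^\perp identifies
    that hyperplane with R^(N-1). The double complements are computed by
    comparing ranks. *)

Set Implicit Arguments.
Unset Strict Implicit.
Unset Printing Implicit Defensive.

Import Order.TTheory GRing.Theory Num.Theory.
Local Open Scope ring_scope.

Lemma modular_vspace (K : fieldType) (vT : vectType K) : modular {vspace vT}.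
Proof. by move=> U V W UW; apply: vspace_modl. Qed.

(** If [V] covers [U], any [v] in [V] outside [U] forces [V = U + <[v]>], and adjoining a line
    raises the dimension by at most one. *)
Lemma dimv_rank_function (K : fieldType) (vT : vectType K) :
  rank_function (fun U : {vspace vT} => \dim U).
Proof.
have dim_lt (U V : {vspace vT}) : (U < V)%O -> (\dim U < \dim V)%N.
  rewrite lt_def => /andP[VU UV].
  by rewrite (ltn_leqif (dimv_leqif_eq UV)) eq_sym.
split=> // U V [UV noW]; move: (UV); rewrite lt_leAnge => /andP[leUV VU].
have [v vV vU] := subvPn VU.
have ltUW : (U < (U + <[v]>)%VS)%O.
  rewrite lt_leAnge; apply/andP; split; first exact: addvSl.
  by apply: contra vU => sWU; apply: (subvP sWU); rewrite memvE addvSr.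
have leWV : ((U + <[v]>)%VS <= V)%O.
  by rewrite [(_ <= _)%O]subv_add -memvE vV andbT; exact: leUV.
have -> : V = (U + <[v]>)%VS.
  apply/eqP; move: (noW (U + <[v]>)%VS); rewrite ltUW /= lt_neqAle leWV andbT.
  by rewrite negbK eq_sym.
apply/eqP; rewrite eqn_leq dim_lt // andbT.
apply: leq_trans (dimv_add_leqif U <[v]>) _.
by rewrite dim_vline -addn1 leq_add2l leq_b1.
Qed.

Section OrderIsomorphism.
Variables (d d' : Order.disp_t) (T : porderType d) (T' : porderType d').
Variables (f : T -> T') (g : T' -> T).
Hypothesis gK : cancel g f.
Hypothesis fle : forall x y, (x <= y)%O = (f x <= f y)%O.

Let flt x y : (x < y)%O = (f x < f y)%O.
Proof. by rewrite !lt_leAnge -!fle. Qed.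

Lemma rank_function_iso (rho : T -> nat) (rho' : T' -> nat) :
  (forall x, rho' (f x) = rho x) -> rank_function rho' -> rank_function rho.
Proof.
move=> rhoE [rho'_lt rho'_cov]; split=> x y.
  by rewrite flt -!rhoE; apply: rho'_lt.
case=> xy noz; rewrite -!rhoE; apply: rho'_cov; split; first by rewrite -flt.
(* Every [z] of [T'] is [f (g z)], so an element strictly between the images would come from one
   strictly between [x] and [y]. *)
by move=> z; rewrite -[z]gK -!flt.
Qed.

Lemma is_lub_iso x y z : is_lub x y z <-> is_lub (f x) (f y) (f z).
Proof.
by split=> h t; [rewrite -[t]gK -!fle | rewrite !fle].
Qed.

Lemma is_glb_iso x y z : is_glb x y z <-> is_glb (f x) (f y) (f z).
Proof.
by split=> h t; [rewrite -[t]gK -!fle | rewrite !fle].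
Qed.

End OrderIsomorphism.

(** Antisymmetry: the bound property tested at [U + V] gives one inclusion, tested at [W] itself the
    other. *)
Lemma is_lub_vspace (K : fieldType) (vT : vectType K) (U V W : {vspace vT}) :
  is_lub U V W <-> W = (U + V)%VS.
Proof.
split=> [lubW | -> t]; last exact: subv_add.
apply: (@subv_anti _ vT); apply/andP; split.
  have := lubW (U + V)%VS; rewrite -![(_ <= _)%O]/(subsetv _ _).
  by rewrite addvSl addvSr.
by have := lubW W; rewrite lexx subv_add => /esym.
Qed.

Lemma is_glb_vspace (K : fieldType) (vT : vectType K) (U V W : {vspace vT}) :
  is_glb U V W <-> W = (U :&: V)%VS.
Proof.
split=> [glbW | -> t]; last exact: subv_cap.
apply: (@subv_anti _ vT); apply/andP; split.
  by have := glbW W; rewrite lexx subv_cap => /esym.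
have := glbW (U :&: V)%VS; rewrite -![(_ <= _)%O]/(subsetv _ _).
by rewrite capvSl capvSr.
Qed.

Lemma ones_complement_basis (R : pzRingType) (k N : nat) :
  (1 + k)%N = N ->
  exists P : 'M[R]_(k, N), exists2 Q : 'M[R]_(N, k),
    P *m Q = 1%:M & P *m (const_mx 1 : 'rV[R]_N)^T = 0.
Proof.
(* The rows of [P] are the differences of a later basis vector and the first one; [Q] forgets the
   first coordinate. *)
move=> <-; exists (row_mx (const_mx (- 1)) 1%:M : 'M_(k, 1 + k)).
exists (col_mx 0 1%:M : 'M_(1 + k, k)).
  by rewrite mul_row_col mulmx0 add0r mulmx1.
rewrite trmx_const -col_mx_const mul_row_col mul1mx.
apply/matrixP=> i j; rewrite !mxE big_ord1 !mxE mulr1.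
by rewrite addNr.
Qed.

Section Complement.
Import VectorInternalTheory.
Variables (R : realType) (N : nat) (vT : vectType R).
Hypothesis dimN : (dim vT).+1 = N.
Variable P : 'M[R]_(dim vT, N).
Hypothesis P_free : row_free P.
Hypothesis P_ones : P *m (const_mx 1 : 'rV[R]_N)^T = 0.

Let ones : 'rV[R]_N := const_mx 1.

Let rank_ones : \rank ones = 1%N.
Proof.
apply/eqP; rewrite eqn_leq rank_leq_row lt0n mxrank_eq0.
(* By [dimN], [N] is a successor, so there is a coordinate at which to read off 1 = 0. *)
apply/eqP => /matrixP/(_ 0 (cast_ord dimN ord0)); rewrite !mxE.
exact/eqP/oner_neq0.
Qed.

Let ker_P : (kermx P^T :=: ones)%MS.
Proof.
apply/eqmx_sym/eqmxP; have sub1P : (ones <= kermx P^T)%MS.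
  by apply/sub_kermxP; rewrite -[LHS]trmxK trmx_mul trmxK P_ones trmx0.
rewrite -(mxrank_leqif_eq sub1P) rank_ones mxrank_ker mxrank_tr (eqP P_free).
by rewrite -dimN subSnn.
Qed.

(** The part of the hyperplane orthogonal to Row(A), in coordinates along the rows of [P]: [c]
    stands for the vector [c *m P]. *)
Definition mx_perp m (A : 'M[R]_(m, N)) : {vspace vT} :=
  mx2vs (kermx (P *m A^T)).

Definition vs_perp (U : {vspace vT}) : 'M[R]_N := kermx (vs2mx U *m P)^T.

Lemma sub_mx_perp m (A : 'M[R]_(m, N)) (U : {vspace vT}) :
  (U <= mx_perp A)%VS = (vs2mx U *m P *m A^T == 0).
Proof. by rewrite /subsetv mx2vsK sub_kermx mulmxA. Qed.

(** A Galois connection: up to transposition, both sides say that the same matrix of scalar products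
    vanishes. *)
Lemma sub_vs_perp m (A : 'M[R]_(m, N)) (U : {vspace vT}) :
  (A <= vs_perp U)%MS = (U <= mx_perp A)%VS.
Proof. by rewrite sub_mx_perp sub_kermx -trmx_eq0 trmx_mul trmxK. Qed.

Lemma ones_vs_perp U : (ones <= vs_perp U)%MS.
Proof. by rewrite sub_vs_perp sub_mx_perp -mulmxA P_ones mulmx0. Qed.

Lemma rank_vs_perp U : (\rank (vs_perp U) + \dim U)%N = N.
Proof.
rewrite mxrank_ker mxrank_tr mxrankMfree // subnK //.
by rewrite (leq_trans (rank_leq_col _)) // -dimN.
Qed.

(** By [ker_P], multiplication by [P^T] kills exactly the line of [ones] inside Row(A), so
    [P *m A^T] has rank [\rank A - 1]; its kernel then has dimension (N - 1) - ([\rank A] - 1). *)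
Lemma dim_mx_perp m (A : 'M[R]_(m, N)) :
  (ones <= A)%MS -> (\dim (mx_perp A) + \rank A)%N = N.
Proof.
move=> oneA; rewrite /dimv mx2vsK mxrank_ker -[in X in (_ - X)%N]mxrank_tr.
rewrite trmx_mul trmxK -(mxrank_mul_ker A P^T) (cap_eqmx (eqmx_refl A) ker_P).
rewrite (capmx_idPr oneA) rank_ones addnA subnK ?addn1 //.
exact: rank_leq_col.
Qed.

Lemma mx_perpS m1 m2 (A : 'M[R]_(m1, N)) (B : 'M[R]_(m2, N)) :
  (A <= B)%MS -> (mx_perp B <= mx_perp A)%VS.
Proof.
by rewrite -sub_vs_perp => AB; apply: submx_trans AB _; rewrite sub_vs_perp.
Qed.

Lemma mx_perpK m (A : 'M[R]_(m, N)) :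
  (ones <= A)%MS -> (vs_perp (mx_perp A) :=: A)%MS.
Proof.
move=> oneA; apply/eqmx_sym/eqmxP.
have sA : (A <= vs_perp (mx_perp A))%MS by rewrite sub_vs_perp.
rewrite -(mxrank_leqif_eq sA) -(eqn_add2r (\dim (mx_perp A))) rank_vs_perp.
by rewrite addnC dim_mx_perp.
Qed.

Lemma vs_perpK : cancel vs_perp (@mx_perp N).
Proof.
move=> U; apply/esym/eqP; rewrite eqEdim -sub_vs_perp submx_refl /=.
rewrite -(leq_add2r (\rank (vs_perp U))) dim_mx_perp ?ones_vs_perp //.
by rewrite addnC rank_vs_perp.
Qed.

Lemma ones_mx_of (A : onesmx R N) : (ones <= mx_of A)%MS.
Proof. by case: A. Qed.

Definition calM_perp (x : calM R N) : {vspace vT} := mx_perp (mx_of (repr x)).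

Definition calM_of_vspace (U : {vspace vT}) : calM R N :=
  cls (@OnesMx R N (Tagged (fun m => 'M[R]_(m, N)) (vs_perp U))
         (ones_vs_perp U)).

Lemma calM_perp_cls A : calM_perp (cls A) = mx_perp (mx_of A).
Proof.
by apply: subv_anti; rewrite !mx_perpS // repr_cls.
Qed.

Lemma calM_perpK : cancel calM_perp calM_of_vspace.
Proof.
move=> x; rewrite -[RHS]reprK; apply/eqP; rewrite [_ == _]eq_cls.
by apply/eqmxP/mx_perpK/ones_mx_of.
Qed.

Lemma calM_of_vspaceK : cancel calM_of_vspace calM_perp.
Proof. by move=> U; rewrite calM_perp_cls; apply: vs_perpK. Qed.

Lemma calM_perp_le x y : (x <= y)%O = (calM_perp x <= calM_perp y)%O.
Proof.
(* The Galois connection moves the complement across; the double complement then returns the row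
   space of [x]. *)
rewrite -[RHS]/(subsetv _ _) -sub_vs_perp.
by rewrite (mx_perpK (ones_mx_of (repr x))).
Qed.

Lemma dim_calM_perp x : \dim (calM_perp x) = rhat x.
Proof.
apply: (@addIn (rk x)); rewrite /rhat subnK ?rank_leq_col //.
exact/dim_mx_perp/ones_mx_of.
Qed.

End Complement.

Theorem theorem3p5 (R : realType) (N : nat) (hN : (1 <= N)%N) :
  [/\ modular {vspace 'rV[R]_(N.-1)},
      rank_function (fun U : {vspace 'rV[R]_(N.-1)} => \dim U),
      rank_function (@rhat R N) &
      exists f : calM R N -> {vspace 'rV[R]_(N.-1)},
        [/\ bijective f,
            forall x y : calM R N, (x <= y)%O = (f x <= f y)%VS,
            forall x y z : calM R N,
              is_lub x y z <-> f z = (f x + f y)%VS,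
            forall x y z : calM R N,
              is_glb x y z <-> f z = (f x :&: f y)%VS &
            forall x : calM R N, \dim (f x) = rhat x]].
Proof.
have dimN : (dim 'rV[R]_(N.-1)).+1 = N.
  (* [hN] makes [N.-1] a true predecessor. *)
  by rewrite -[dim _]/(1 * N.-1)%N mul1n prednK.
have [P [Q PQ P1]] := ones_complement_basis R dimN.
have P_free : row_free P by apply/row_freeP; exists Q.
have fK := calM_perpK dimN P_free P1.
have gK := calM_of_vspaceK dimN P_free P1.
have fle := calM_perp_le dimN P_free P1.
have fdim := dim_calM_perp dimN P_free P1.
split; [exact: modular_vspace | exact: dimv_rank_function | |].
  exact: (rank_function_iso gK fle fdim (@dimv_rank_function _ _)).
exists (calM_perp P); split=> //; first by exists (calM_of_vspace P1).
- by move=> x y z; rewrite (is_lub_iso gK fle) is_lub_vspace.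
- by move=> x y z; rewrite (is_glb_iso gK fle) is_glb_vspace.
Qed.
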